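(* Let $C$ be the middle-third Cantor set, $\mu$ the natural Cantor probability measure on $C$, and $\gamma=\frac{\log 2}{\log 3}$. Let $\tau>2-\gamma$ be a real number. Then \[ \mu\left(\left\{x\in C:\ \|2^n x\|<n^{-\tau}\ \text{for infinitely many } n\in\mathbb N\right\}\right)=0 . \]
   Context: The middle-third Cantor set is $C=\{x\in[0,1]: x=\sum_{k=1}^\infty a_k 3^{-k},\ a_k\in\{0,2\}\}$. The natural Cantor probability measure $\mu$ is the law of $\sum_{k\ge1}a_k3^{-k}$ with $a_k$ independent and uniformly distributed on $\{0,2\}$. For $t\in\mathbb R$, $\|t\|=\min_{m\in\mathbb Z}|t-m|$ is the distance to the nearest integer. *)

(* Defs.v *)
From HB Require Import structures.
From mathcomp Require Import all_boot all_order all_algebra finmap.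
From mathcomp Require Import all_classical all_reals all_analysis.

Set Implicit Arguments.
Unset Strict Implicit.
Unset Printing Implicit Defensive.

Import Order.TTheory GRing.Theory Num.Theory.
Import numFieldNormedType.Exports.

Local Open Scope classical_set_scope.
Local Open Scope ring_scope.

(** The infimum is attained, so this is the minimum over the integers. *)
Definition dist_int (R : realType) (t : R) : R :=
  inf (range (fun m : int => `|t - m%:~R|)).

(** [a k] is the digit written a_(k+1) in the expansion
    x = \sum_(k >= 1) a_k 3^(-k): digits are numbered from 0 here. *)
Definition ternary_expansion (R : realType) (a : R^nat) (x : R) : Prop :=
  series (fun k => a k / 3 ^+ k.+1) @ \oo --> x.

Definition cantor_set (R : realType) : set R :=
  [set x | 0 <= x <= 1 /\
     exists a : R^nat, (forall k, a k = 0 \/ a k = 2) /\ ternary_expansion a x].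

Definition mutually_independent d (T : measurableType d) (R : realType)
    (P : probability T R) (X : nat -> {RV P >-> R}) : Prop :=
  forall (J : {fset nat}) (A : nat -> set R),
    (forall j, j \in J -> measurable (A j)) ->
    P (\bigcap_(j in [set` J]) (X j @^-1` A j)) =
      (\prod_(j <- J) P (X j @^-1` A j))%E.
Arguments mutually_independent {d T R} P X.

Definition uniform_on_02 d (T : measurableType d) (R : realType)
    (P : probability T R) (X : {RV P >-> R}) : Prop :=
  distribution P X [set 0] = (2^-1)%:E /\ distribution P X [set 2] = (2^-1)%:E.
Arguments uniform_on_02 {d T R} P X.

(** [mu] is the law of \sum_(k >= 1) a_k 3^(-k) for independent [a k], uniform
    on {0, 2}.  Such digits lie in {0, 2} only almost surely, hence the
    almost sure convergence.  This determines [mu] on all Borel sets. *)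
Definition is_cantor_measure (R : realType)
    (mu : probability (measurableTypeR R) R) : Prop :=
  exists (d : measure_display) (T : measurableType d) (P : probability T R)
         (a : nat -> {RV P >-> R}) (X : {RV P >-> R}),
    [/\ mutually_independent P a,
        forall k, uniform_on_02 P (a k),
        {ae P, forall w, ternary_expansion (fun k => a k w) (X w)}
      & forall B : set R, measurable B -> mu B = distribution P X B].

(* Main.v *)
(* Write [x] in [C] as [p / 3 ^ L + z / 3 ^ L], with [p] its first [L] digits and
   [z] an independent point with the same law.  If [||2 ^ n x|| < d] then
   [||2 ^ n z|| < 3 ^ L d], and [z] determines [p] modulo [3 ^ L]: splitting off [L]
   digits gains a factor [2 ^ - L].  The remaining event, for [n] in a block
   [[3 ^ l, 3 ^ (l + 1)[], is bounded through a Fejer kernel by Fourier coefficients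
   of the Cantor measure, whose absolute values at integers are
   [prod_j |cos (2 pi h 2 ^ n / 3 ^ j)|].  Since 2 generates the units modulo
   [3 ^ (l + 1)], the numbers [h 2 ^ n] run over distinct residues, and
   [|cos t| + |cos (t + 2 pi / 3)| + |cos (t + 4 pi / 3)| <= 2] bounds the sum of
   these products over all residues by [2 ^ (l + 1)].  Altogether the block has
   measure [O ((3 / 2) ^ L (3 / T) ^ l + 2 ^ (l - L))] with [T = 3 ^ tau]; taking [L]
   slightly larger than [l], this is summable as soon as [T > 9 / 2], which is
   [tau > 2 - log 2 / log 3]. *)
Require Import Defs.
From HB Require Import structures.
From mathcomp Require Import all_boot all_order all_algebra finmap.
From mathcomp Require Import all_classical all_reals all_analysis.
From mathcomp Require Import measurable_realfun zify ring lra.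

Import Order.TTheory GRing.Theory Num.Theory.
Import numFieldNormedType.Exports.

Local Open Scope classical_set_scope.
Local Open Scope ring_scope.

(** * Cosines of full turns *)

(** Angles are measured in turns, so that every integer is a period. *)
Definition cosc {R : realType} (t : R) : R := cos (t * (pi *+ 2)).
Definition sinc {R : realType} (t : R) : R := sin (t * (pi *+ 2)).

Section CosTurn.
Variable R : realType.
Implicit Types (s t : R) (n : nat) (i : int).

Lemma cosc_addn t n : cosc (t + n%:R) = cosc t.
Proof.
rewrite /cosc mulrDl mulr_natl.
exact: (periodicn (@cosD2pi R)).
Qed.

Lemma cosc_addz t i : cosc (t + i%:~R) = cosc t.
Proof.
case: i => n; first by rewrite -pmulrn cosc_addn.
by rewrite NegzE -[LHS](cosc_addn _ n.+1) mulrNz -pmulrn subrK.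
Qed.

Lemma coscN t : cosc (- t) = cosc t.
Proof. by rewrite /cosc mulNr cosN. Qed.

Lemma coscD s t : cosc (s + t) = cosc s * cosc t - sinc s * sinc t.
Proof. by rewrite /cosc mulrDl cosD. Qed.

Lemma coscB s t : cosc (s - t) = cosc s * cosc t + sinc s * sinc t.
Proof. by rewrite /cosc mulrBl cosB. Qed.

Lemma normr_cosc_le1 t : `|cosc t| <= 1.
Proof. exact: cos_max. Qed.

(** At [pi / 3] the triple-angle formula gives [(c + 1) (2 c - 1) ^ 2 = 0] for the cosine [c], and
    [c > 0] excludes the root [-1]. *)
Lemma cosc_sixth : cosc (6^-1 : R) = 2^-1.
Proof.
have -> : cosc (6^-1 : R) = cos (pi / 3).
  by rewrite /cosc; congr cos; field.
set x : R := pi / 3; have pi0 := pi_gt0 R.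
have c0 : 0 < cos x by apply: cos_gt0_pihalf; rewrite /x; lra.
have cos3 : cos (x + x + x) = -1 by rewrite -(cospi R); congr cos; rewrite /x; field.
have s2 := cos2Dsin2 x.
have : (cos x + 1) * (cos x * 2 - 1) ^+ 2 = 0.
  move: cos3; rewrite cosD cosD sinD => cos3.
  have -> : (cos x + 1) * (cos x * 2 - 1) ^+ 2 = 4 * cos x ^+ 3 - 3 * cos x + 1 by ring.
  have -> : 4 * cos x ^+ 3 - 3 * cos x + 1 =
    4 * cos x ^+ 3 - 3 * cos x * (cos x ^+ 2 + sin x ^+ 2) + 1 by rewrite s2 mulr1.
  by rewrite -[X in _ + X]opprK -cos3; ring.
move/eqP; rewrite mulf_eq0 sqrf_eq0 => /orP[] /eqP; lra.
Qed.

Lemma cosc_ge_half t : `|t| <= 6^-1 -> 2^-1 <= cosc t.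
Proof.
move=> ht; rewrite -cosc_sixth /cosc -[leRHS]cos_norm normrM.
have pi0 := pi_gt0 R.
have p2 : 0 <= pi *+ 2 :> R by lra.
rewrite (ger0_norm p2).
case: (ltgtP `|t| 6^-1) ht => // [lt6|->] _ //.
have t0 := normr_ge0 t.
by apply/ltW; rewrite ltr_cos ?in_itv/= ?ltr_pM2r; first [lra|nra].
Qed.

Lemma cosc_third : cosc (3^-1 : R) = - 2^-1.
Proof.
rewrite /cosc (_ : 3^-1 * (pi *+ 2) = pi - 6^-1 * (pi *+ 2)); last by field.
by rewrite cosB cospi sinpi -/(cosc _) cosc_sixth; ring.
Qed.

(* The three cosines sum to zero, so the sum of their absolute values is twice
   the largest of them. *)
Lemma sum_norm_cosc_thirds t :
  `|cosc t| + `|cosc (t + 3^-1)| + `|cosc (t + 2 / 3)| <= 2.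
Proof.
have -> : cosc (t + 2 / 3) = cosc (t - 3^-1).
  by rewrite -[RHS](cosc_addn _ 1); congr cosc; field.
have : cosc t + cosc (t + 3^-1) + cosc (t - 3^-1) = 0.
  by rewrite coscD coscB cosc_third; field.
have := normr_cosc_le1 t; have := normr_cosc_le1 (t + 3^-1).
have := normr_cosc_le1 (t - 3^-1).
move: (cosc t) (cosc (t + _)) (cosc (t - _)) => x y z.
rewrite !ler_norml => /andP[z1 z2] /andP[y1 y2] /andP[x1 x2] xyz.
by case: (ger0P x) => hx; case: (ger0P y) => hy; case: (ger0P z) => hz; lra.
Qed.

End CosTurn.

(** * Distance to the nearest integer and the Fejer kernel *)

Lemma dist_int_ltP (R : realType) (t e : R) :
  reflect (exists i : int, `|t - i%:~R| < e) (dist_int t < e).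
Proof.
have hinf : has_inf (range (fun m : int => `|t - m%:~R|)).
  by split; [exists `|t - 0%:~R|, 0 | exists 0 => _ [m _ <-]].
apply: (iffP idP) => [lt_e | [i lt_e]].
  have /inf_adherent/(_ hinf)[_ [i _ <-]] : 0 < e - dist_int t by rewrite subr_gt0.
  by rewrite -/(dist_int t) subrKC; exists i.
by apply: le_lt_trans lt_e; apply: ge_inf; [case: hinf | exists i].
Qed.

(* Fejer kernel: the square of the sum of cosines alone is at least [K ^ 2 / 4]
   near the integers, and the double sum also contains that of the sines. *)
Lemma fejer_indicator (R : realType) (K : nat) (t : R) : (0 < K)%N ->
  (dist_int t < (6 * K%:R)^-1)%R%:R <=
    4 / K%:R ^+ 2 * \sum_(j < K) \sum_(k < K) cosc ((j%:R - k%:R) * t).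
Proof.
move=> K0; have K0' : 0 < K%:R :> R by rewrite ltr0n.
have -> : \sum_(j < K) \sum_(k < K) cosc ((j%:R - k%:R) * t) =
    (\sum_(j < K) cosc (j%:R * t)) ^+ 2 + (\sum_(j < K) sinc (j%:R * t)) ^+ 2.
  rewrite !expr2 !mulr_suml -big_split; apply: eq_bigr => j _ /=.
  rewrite !mulr_sumr -big_split; apply: eq_bigr => k _ /=.
  by rewrite mulrBl coscB.
case: dist_int_ltP => [[i lt_i]|_]; last first.
  by rewrite mulr_ge0 ?addr_ge0 ?sqr_ge0 // divr_ge0 ?sqr_ge0.
have : K%:R / 2 <= \sum_(j < K) cosc (j%:R * t).
  rewrite [leLHS](_ : _ = \sum_(j < K) 2^-1); last first.
    by rewrite sumr_const card_ord -[RHS]mulr_natl.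
  apply: ler_sum => j _.
  have -> : j%:R * t = j%:R * (t - i%:~R) + (i *+ j)%:~R.
    by rewrite mulrBr raddfMn /= -[i%:~R *+ j]mulr_natl subrK.
  (* The radius [1 / (6 K)] keeps every multiple [j (t - i)] with [j < K] within a sixth of a turn,
     where the cosine is at least [1 / 2]. *)
  rewrite cosc_addz; apply: cosc_ge_half.
  rewrite normrM normr_nat.
  have -> : 6^-1 = K%:R * (6 * K%:R)^-1 :> R by field; lra.
  by apply: ler_pM => //; [rewrite ler_nat ltnW|exact: ltW].
move=> hS; rewrite mulr1n -[leLHS](_ : 4 / K%:R ^+ 2 * (K%:R / 2) ^+ 2 = 1); last first.
  by field; lra.
rewrite ler_pM2l ?divr_gt0 ?exprn_gt0 //.
apply: le_trans (_ : _ <= (\sum_(j < K) cosc (j%:R * t)) ^+ 2) _.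
  have K2 : 0 <= K%:R / 2 :> R by rewrite divr_ge0.
  by rewrite lerXn2r ?nnegrE // (le_trans K2).
by rewrite lerDl sqr_ge0.
Qed.

(** * Integers with ternary digits 0 and 2 *)

(** For [a] in this list, [a / 3 ^ m] runs over the left endpoints of the intervals of level [m] in
    the construction of the Cantor set. *)
Fixpoint cantor_ints (m : nat) : seq nat :=
  if m is m'.+1
  then [seq (3 * a + e)%N | a <- cantor_ints m', e <- [:: 0%N; 2%N]]
  else [:: 0%N].

Section CantorInts.
Variable R : realType.
Implicit Types (F : nat -> R).

Lemma cantor_intsS m : cantor_ints m.+1 =
  [seq (3 * a + e)%N | a <- cantor_ints m, e <- [:: 0%N; 2%N]].
Proof. by []. Qed.

Lemma sum_cantor_intsS m F : \sum_(a <- cantor_ints m.+1) F a =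
  \sum_(a <- cantor_ints m) (F (3 * a)%N + F (3 * a + 2)%N).
Proof.
rewrite cantor_intsS big_allpairs_dep/=; apply: eq_bigr => a _.
by rewrite !big_cons big_nil addr0 addn0.
Qed.

Lemma size_cantor_ints m : size (cantor_ints m) = (2 ^ m)%N.
Proof.
by elim: m => // m IH; rewrite cantor_intsS size_allpairs IH expnSr.
Qed.

Lemma ltn_cantor_ints m a : a \in cantor_ints m -> (a < 3 ^ m)%N.
Proof.
elim: m a => [|m IH] a; first by rewrite inE => /eqP ->.
rewrite cantor_intsS => /allpairsP[[b e] /= [/IH hb he ->]].
by move: he; rewrite !inE expnS => /orP[] /eqP ->; lia.
Qed.

Lemma uniq_cantor_ints m : uniq (cantor_ints m).
Proof.
elim: m => // m IH; rewrite cantor_intsS allpairs_uniq //.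
by move=> [a e] [b f] /allpairsP[[? ?] [_ + [-> ->]]] /allpairsP[[? ?] [_ + [-> ->]]];
  rewrite !inE /= => /orP[] /eqP -> /orP[] /eqP -> ?; congr (_, _); lia.
Qed.

(** Concatenation of digit strings, with [p] the leading [L] digits and [z] the last [M]: the
    discrete form of the self-similarity of the Cantor measure. *)
Lemma sum_cantor_intsD L M F : \sum_(a <- cantor_ints (L + M)) F a =
  \sum_(p <- cantor_ints L) \sum_(z <- cantor_ints M) F (3 ^ M * p + z)%N.
Proof.
elim: M F => [|M IH] F.
  rewrite addn0; apply: eq_bigr => p _.
  by rewrite big_seq1 expn0 mul1n addn0.
rewrite addnS sum_cantor_intsS IH; apply: eq_bigr => p _.
rewrite sum_cantor_intsS; apply: eq_bigr => z _.
by rewrite expnS; congr (F _ + F _); lia.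
Qed.

Lemma sum_bool_count (T : Type) (P : pred T) (s : seq T) :
  \sum_(x <- s) (P x : nat) = count P s.
Proof. by rewrite -sum1_count [RHS]big_mkcond. Qed.

Lemma count_le1 (T : eqType) (P : pred T) (s : seq T) : uniq s ->
  {in s &, forall x y, P x -> P y -> x = y} -> (count P s <= 1)%N.
Proof.
move=> us uP; rewrite -size_filter.
case E : (seq.filter P s) => [|x [|y t]] //.
have : uniq (seq.filter P s) by rewrite seq.filter_uniq.
rewrite E /= inE negb_or -andbA => /andP[/eqP xy _].
have /[!mem_filter]/andP[Px sx] : x \in seq.filter P s by rewrite E inE eqxx.
have /[!mem_filter]/andP[Py sy] : y \in seq.filter P s by rewrite E !inE eqxx orbT.
by case: xy; apply: uP.
Qed.

(* Once [2 ^ n * z / 3 ^ M] is within [3 ^ L * e <= 1 / 2] of an integer, that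
   integer determines [p] modulo [3 ^ L]. *)
Lemma count_first_digits L M n z (e : R) : 3 ^+ L * e <= 2^-1 ->
  \sum_(p <- cantor_ints L)
    ((dist_int (2 ^+ n * ((3 ^ M * p + z)%N%:R / 3 ^+ (L + M)) : R) < e)%R%:R : R) <=
  (dist_int (2 ^+ n * (z%:R / 3 ^+ M) : R) < 3 ^+ L * e)%R%:R.
Proof.
move=> he; have L0 : 0 < 3 ^+ L :> R by rewrite exprn_gt0.
have M0 : 0 < 3 ^+ M :> R by rewrite exprn_gt0.
pose P p := dist_int (2 ^+ n * ((3 ^ M * p + z)%N%:R / 3 ^+ (L + M)) : R) < e.
(* Multiplication by [3 ^ L] turns the [p] part of the point into the integer [2 ^ n * p], so an
   integer near the point gives one near [2 ^ n * z / 3 ^ M]. *)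
have hP p : P p -> exists i : int,
    `|2 ^+ n * (z%:R / 3 ^+ M) - ((3 ^ L)%:Z * i - (2 ^ n * p)%:Z)%:~R| < 3 ^+ L * e.
  move=> /dist_int_ltP[i hi]; exists i.
  have {hi} : 3 ^+ L * `|2 ^+ n * ((3 ^ M * p + z)%N%:R / 3 ^+ (L + M)) - i%:~R| < 3 ^+ L * e.
    by rewrite ltr_pM2l.
  rewrite -[X in X * _](ger0_norm (ltW L0)) -normrM; congr (_ < _); congr `|_|.
  rewrite rmorphB rmorphM /= -!pmulrn !natrD !natrM !natrX !exprD.
  by field; apply/andP; split; apply: lt0r_neq0.
rewrite -natr_sum (sum_bool_count _ P) ler_nat.
have [/hasP[p pL /hP[i hi]]|] := boolP (has P (cantor_ints L)); last first.
  by rewrite has_count -leqNgt => /leq_trans ->.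
have -> : dist_int (2 ^+ n * (z%:R / 3 ^+ M) : R) < 3 ^+ L * e.
  by apply/dist_int_ltP; eexists; exact: hi.
apply: (count_le1 _ _ _ (uniq_cantor_ints L)) => q r qL rL /hP[j hj] /hP[k hk].
(* Both integers lie at distance less than [1 / 2] from the same real, hence agree. *)
have eqL : (3 ^ L)%:Z * j - (2 ^ n * q)%:Z = (3 ^ L)%:Z * k - (2 ^ n * r)%:Z.
  move: ((3 ^ L)%:Z * j - _) hj ((3 ^ L)%:Z * k - _) hk => A hj B hk.
  have AB : (A - 1)%:~R < B%:~R :> R.
    by rewrite rmorphB /=; move: hj hk; rewrite !ltr_norml; lra.
  have BA : (B - 1)%:~R < A%:~R :> R.
    by rewrite rmorphB /=; move: hj hk; rewrite !ltr_norml; lra.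
  by move: AB BA; rewrite !ltr_int; lia.
(* As 2 is invertible modulo [3 ^ L], the prefixes [q] and [r] are congruent; both are below
   [3 ^ L], so they are equal. *)
have : ((3 ^ L)%:Z %| (2 ^ n)%:Z * (q%:Z - r%:Z))%Z.
  by apply/dvdzP; exists (j - k); rewrite mulrBr mulrBl; move: eqL; rewrite !PoszM; lia.
rewrite Gauss_dvdzr ?coprimezE /= ?coprimeXl ?coprimeXr // => /dvdzP[c].
have := ltn_cantor_ints _ _ qL; have := ltn_cantor_ints _ _ rL.
move: (3 ^ L)%N => N rN qN hc; have : c = 0 by nia.
by move=> c0; move: hc; rewrite c0; lia.
Qed.
End CantorInts.

(** * Riesz products *)

(** The modulus at frequency [x] of the Fourier transform of the uniform measure on the points
    [z / 3 ^ M], [z] in [cantor_ints M]. *)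
Definition riesz {R : realType} (M : nat) (x : R) : R :=
  \prod_(j < M) `|cosc (x / 3 ^+ j.+1)|.

Section Riesz.
Variable R : realType.
Implicit Types (x : R) (M l : nat).

Lemma riesz_ge0 M x : 0 <= riesz M x.
Proof. exact: prodr_ge0. Qed.

(** Each new digit, 0 or 2, contributes [cos (A - s) + cos (A + s) = 2 cos s cos A]. The midpoint
    [A] carries an extra phase [s], which is why the induction runs over all [phi]. *)
Lemma norm_sum_cosc_cantor M x phi :
  `|\sum_(z <- cantor_ints M) cosc (x * (z%:R / 3 ^+ M) + phi)| <=
    2 ^+ M * riesz M x.
Proof.
elim: M phi => [|M IH] phi.
  by rewrite big_seq1 /riesz big_ord0 mulr1 expr0 normr_cosc_le1.
set s := x / 3 ^+ M.+1.
have -> : \sum_(z <- cantor_ints M.+1) cosc (x * (z%:R / 3 ^+ M.+1) + phi) =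
    2 * cosc s * \sum_(z <- cantor_ints M) cosc (x * (z%:R / 3 ^+ M) + (phi + s)).
  rewrite sum_cantor_intsS mulr_sumr; apply: eq_bigr => z _.
  have n0 : 3 ^+ M != 0 :> R by rewrite expf_neq0.
  set A := x * (z%:R / 3 ^+ M) + (phi + s).
  have -> : x * ((3 * z)%:R / 3 ^+ M.+1) + phi = A - s.
    by rewrite /A /s natrM exprS; field.
  have -> : x * ((3 * z + 2)%:R / 3 ^+ M.+1) + phi = A + s.
    by rewrite /A /s natrD natrM exprS; field.
  by rewrite (coscB _ A s) (coscD _ A s); ring.
rewrite normrM /riesz big_ord_recr /= -/(riesz M x) -/s exprS.
rewrite normrM ger0_norm // -!mulrA ler_pM2l // mulrC [leRHS]mulrA.
by apply: ler_wpM2r.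
Qed.

Lemma riesz_addn l x k : riesz l (x + (3 ^ l * k)%:R) = riesz l x.
Proof.
apply: eq_bigr => j _; congr `|_|.
have -> : (x + (3 ^ l * k)%:R) / 3 ^+ j.+1 = x / 3 ^+ j.+1 + (3 ^ (l - j.+1) * k)%:R.
  rewrite mulrDl -[in (3 ^ l)%N](subnK (ltn_ord j)) expnD !natrM !natrX; field.
  by rewrite expf_neq0.
by rewrite cosc_addn.
Qed.

Lemma riesz_modn l u : riesz l ((u %% 3 ^ l)%:R : R) = riesz l u%:R.
Proof.
by rewrite [in RHS](divn_eq u (3 ^ l)) addnC mulnC natrD riesz_addn.
Qed.

(** The residues [u], [u + 3 ^ l], [u + 2 * 3 ^ l] share their first [l] factors, and their last
    factors differ by thirds of a turn. By [sum_norm_cosc_thirds] each level costs a factor 2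
    instead of 3. *)
Lemma sum_riesz l : \sum_(0 <= u < 3 ^ l) riesz l (u%:R : R) <= 2 ^+ l.
Proof.
elim: l => [|l IH].
  by rewrite big_nat1 /riesz big_ord0 expr0.
have n0 k : 3 ^+ k != 0 :> R by rewrite expf_neq0.
have E k u : riesz l.+1 ((u + 3 ^ l * k)%:R : R) =
    riesz l (u%:R : R) * `|cosc (u%:R / 3 ^+ l.+1 + k%:R / 3)|.
  rewrite /riesz big_ord_recr /= -/(riesz l _) natrD riesz_addn; congr (_ * `|cosc _|).
  by rewrite natrM natrX exprS; field.
rewrite (_ : 3 ^ l.+1 = 3 ^ l + 3 ^ l + 3 ^ l)%N; last by rewrite expnS; lia.
rewrite (@big_cat_nat _ _ _ (3 ^ l + 3 ^ l)) ?leq_addr //=.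
rewrite (@big_cat_nat _ _ _ (3 ^ l)) ?leq_addr //=.
have shift a : \sum_(a <= u < a + 3 ^ l) riesz l.+1 (u%:R : R) =
    \sum_(0 <= u < 3 ^ l) riesz l.+1 (u + a)%:R.
  by rewrite -{1}[a]add0n big_addn addKn.
rewrite !shift -!big_split /=.
apply: le_trans (_ : _ <= \sum_(0 <= u < 3 ^ l) 2 * riesz l u%:R) _; last first.
  by rewrite -mulr_sumr exprS ler_pM2l.
apply: ler_sum => u _.
have := E 0%N u; have := E 1%N u; have := E 2%N u.
rewrite muln0 addn0 muln1 muln2 -addnn => -> -> ->.
rewrite mul0r addr0 div1r -!mulrDr mulrC ler_wpM2r ?riesz_ge0 //.
exact: sum_norm_cosc_thirds.
Qed.

(** Factors [v] to [v + l - 1] of the left side are those of [riesz l x]; all the others are at most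
    1. *)
Lemma riesz_mul_exp3 v l M x : (v + l <= M)%N ->
  riesz M (3 ^+ v * x) <= riesz l x.
Proof.
move=> vlM; rewrite /riesz -(big_mkord xpredT (fun j => `|cosc (3 ^+ v * x / 3 ^+ j.+1)|)).
rewrite (@big_cat_nat _ _ _ v) //=; last lia.
rewrite (@big_cat_nat _ _ _ (v + l)%N v) //=; last lia.
set A := \prod_(0 <= i < v) _; set B := \prod_(_ <= i < _) _; set C := \prod_(v + l <= i < _) _.
have -> : B = \prod_(i < l) `|cosc (x / 3 ^+ i.+1)|.
  rewrite /B -[X in \prod_(X <= _ < _) _]add0n big_addn addKn big_mkord; apply: eq_bigr => i _.
  congr `|cosc _|; rewrite addnC -addnS exprD; field.
  by rewrite !expf_neq0.
rewrite mulrCA ler_piMr ?prodr_ge0 //.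
by rewrite mulr_ile1 ?prodr_ge0 ?prodr_ile1 // => i _; rewrite normr_ge0 normr_cosc_le1.
Qed.

End Riesz.

(** * Powers of two modulo powers of three *)

Section PowersOfTwo.
Local Open Scope nat_scope.

(** Cubing [1 + 3 ^ (l + 1) c] raises the exponent of 3 in the second term by exactly one. *)
Lemma exp4_exp3 l : exists2 c, 4 ^ (3 ^ l) = 1 + 3 ^ l.+1 * c & ~~ (3 %| c).
Proof.
elim: l => [|l [c hc c3]]; first by exists 1.
exists (c + 3 * (3 ^ l * c * c + 3 ^ l * 3 ^ l * c * c * c)).
  by rewrite expnSr expnM hc !expnS expn0; ring.
by rewrite dvdn_addl ?dvdn_mulr.
Qed.

(** The binomial expansion to first order, modulo [9 q]. *)
Lemma expn_1add s q c : exists k, (1 + 3 * q * c) ^ s = 1 + 3 * q * (s * c + 3 * k).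
Proof.
elim: s => [|s [k hk]]; first by exists 0; rewrite expn0; ring.
exists (k + q * c * (s * c + 3 * k)).
by rewrite expnS hk; ring.
Qed.

(** This says that 2 is a primitive root modulo [3 ^ (l + 1)]. In the induction [i = 2 * 3 ^ l * s],
    and [2 ^ i] is [1 + 3 ^ (l + 1) s c] modulo [3 ^ (l + 2)] with [c] prime to 3, which forces 3 to
    divide [s]. *)
Lemma order_2_exp3 l i : 3 ^ l.+1 %| 2 ^ i - 1 -> 2 * 3 ^ l %| i.
Proof.
elim: l i => [|l IH] i.
  have -> : 2 ^ i = (1 + 3 * 1 * 1) ^ (i %/ 2) * 2 ^ (i %% 2).
    by rewrite {1}(divn_eq i 2) expnD [_ * 2]mulnC expnM.
  have [k ->] := expn_1add (i %/ 2) 1 1.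
  have : i %% 2 < 2 by rewrite ltn_mod.
  rewrite expn0 expn1 muln1 /dvdn => lt2.
  have [->|->] // : i %% 2 = 0 \/ i %% 2 = 1 by lia.
  by rewrite expn1; lia.
move=> h; have /dvdnP[s hs] : 2 * 3 ^ l %| i.
  by apply: IH; apply: dvdn_trans h; rewrite dvdn_exp2l.
have [c hc c3] := exp4_exp3 l.
move: h; rewrite hs mulnC !expnM -[2 ^ 2]/4 hc.
have [k] := expn_1add s (3 ^ l) c; rewrite -expnS => ->.
rewrite addKn expnSr dvdn_pmul2l ?expn_gt0 // dvdn_addl; last exact: dvdn_mulr.
rewrite Euclid_dvdM // (negbTE c3) orbF => /dvdnP[t ->].
by apply/dvdnP; exists t; rewrite expnS; ring.
Qed.

(** The block has length [2 * 3 ^ l], exactly the order of 2 modulo [3 ^ (l + 1)]. *)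
Lemma mul_exp2_inj l h : coprime 3 h ->
  {in index_iota (3 ^ l) (3 ^ l.+1) &, injective (fun n => (h * 2 ^ n) %% 3 ^ l.+1)}.
Proof.
move=> h3 m n; rewrite !mem_index_iota => /andP[lm um] /andP[ln un].
wlog mn : m n lm um ln un / m <= n => [H|].
  by case: (leqP m n) => [/H|/ltnW/H] H' // E; [apply: H'|apply/esym/H'].
move=> /esym/eqP; rewrite eqn_mod_dvd ?leq_mul ?leq_exp2l //.
have -> : h * 2 ^ n - h * 2 ^ m = h * 2 ^ m * (2 ^ (n - m) - 1).
  by rewrite mulnBr muln1 -mulnA -expnD subnKC.
rewrite Gauss_dvdr ?coprimeMr ?coprimeXl ?coprimeXr // => /order_2_exp3/dvdnP[c].
case: c => [|c]; first by rewrite mul0n; lia.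
by move: lm un; rewrite expnS mulSn => *; lia.
Qed.

End PowersOfTwo.

(** * Fourier sums and counts over a block of exponents *)

Section BlockSum.
Variable R : realType.

Lemma ler_sum_inj (G : nat -> R) (f : nat -> nat) (s : seq nat) (N : nat) :
  (forall u, 0 <= G u) -> uniq s -> {in s &, injective f} ->
  (forall x, (f x < N)%N) ->
  \sum_(x <- s) G (f x) <= \sum_(0 <= u < N) G u.
Proof.
move=> G0 us finj fN; rewrite -(big_map f xpredT G).
have ut : uniq (map f s) by rewrite map_inj_in_uniq.
rewrite (perm_big (seq.filter (fun u => u \in map f s) (index_iota 0 N))); last first.
  apply: uniq_perm => //; first by rewrite seq.filter_uniq ?iota_uniq.
  move=> u; rewrite mem_filter mem_index_iota andb_idr // => /mapP[x _ ->].
  exact: fN.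
by rewrite big_filter big_mkcond; apply: ler_sum => u _; case: ifP.
Qed.

(** Write [h = 3 ^ v * h'] with [h'] prime to 3. The power of 3 uses up [v < h] factors, which
    [h + l < M] leaves room for, and the numbers [h' * 2 ^ n] are distinct modulo [3 ^ (l + 1)], so
    the sum over all residues dominates. *)
Lemma block_sum_riesz l M h : (0 < h)%N -> (h + l < M)%N ->
  \sum_(3 ^ l <= n < 3 ^ l.+1) riesz M ((h * 2 ^ n)%:R : R) <= 2 ^+ l.+1.
Proof.
move=> h0 hlM.
have [h' h3 def_h] := pfactor_coprime (isT : prime 3) h0.
set v := logn 3 h in def_h.
have vh : (v < h)%N by rewrite ltn_logl.
apply: le_trans (sum_riesz R l.+1).
apply: le_trans (_ : _ <= \sum_(3 ^ l <= n < 3 ^ l.+1)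
    riesz l.+1 ((h' * 2 ^ n) %% 3 ^ l.+1)%:R) _; last first.
  apply: (ler_sum_inj (fun u => riesz l.+1 u%:R)) => [u|||n].
  - exact: riesz_ge0.
  - exact: iota_uniq.
  - exact: mul_exp2_inj.
  - by rewrite ltn_pmod ?expn_gt0.
apply: ler_sum => n _; rewrite riesz_modn def_h mulnAC mulnC natrM natrX.
by apply: riesz_mul_exp3; lia.
Qed.

End BlockSum.

Section BlockCount.
Variable R : realType.

Lemma rieszN M (x : R) : riesz M (- x) = riesz M x.
Proof. by apply: eq_bigr => j _; rewrite mulNr coscN. Qed.

Lemma block_sum_cosc l M h : (0 < h)%N -> (h + l < M)%N ->
  forall x : R, `|x| = h%:R ->
  \sum_(3 ^ l <= n < 3 ^ l.+1) \sum_(z <- cantor_ints M)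
    cosc (x * (2 ^+ n * (z%:R / 3 ^+ M))) <= 2 ^+ M * 2 ^+ l.+1.
Proof.
move=> h0 hlM x hx.
apply: le_trans (_ : _ <= \sum_(3 ^ l <= n < 3 ^ l.+1) 2 ^+ M * riesz M (h * 2 ^ n)%:R) _.
  apply: ler_sum => n _; apply: le_trans (ler_norm _) _.
  have -> : riesz M ((h * 2 ^ n)%:R : R) = riesz M (x * 2 ^+ n).
    rewrite natrM natrX -hx; case: (ger0P x) => // _.
    by rewrite mulNr rieszN.
  have := norm_sum_cosc_cantor R M (x * 2 ^+ n) 0.
  by under eq_bigr do rewrite addr0 -mulrA.
by rewrite -mulr_sumr ler_pM2l ?exprn_gt0 // block_sum_riesz.
Qed.

(** After [count_first_digits], the Fejer kernel is summed over pairs [(j, k)]. The [K] diagonal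
    pairs have no cancellation and give [8 * 3 ^ l / K]; for the others [block_sum_cosc] at
    frequency [j - k] applies. Its bound, taken for all [K ^ 2] pairs, gives [8 * 2 ^ l]. *)
Lemma block_count l L M K (e : R) : (0 < K)%N -> (K + l < M)%N ->
  3 ^+ L * e <= (6 * K%:R)^-1 ->
  \sum_(3 ^ l <= n < 3 ^ l.+1) \sum_(v <- cantor_ints (L + M))
    ((dist_int (2 ^+ n * (v%:R / 3 ^+ (L + M)) : R) < e)%R%:R : R) <=
  2 ^+ M * (8 * 3 ^+ l / K%:R + 8 * 2 ^+ l).
Proof.
move=> K0 KlM he; have K0' : 0 < K%:R :> R by rewrite ltr0n.
have K1 : 1 <= K%:R :> R by rewrite ler1n.
pose c j k n z : R := cosc ((j%:R - k%:R) * (2 ^+ n * (z%:R / 3 ^+ M))).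
apply: le_trans (_ : _ <= \sum_(3 ^ l <= n < 3 ^ l.+1) \sum_(z <- cantor_ints M)
    4 / K%:R ^+ 2 * \sum_(j < K) \sum_(k < K) c j k n z) _.
  apply: ler_sum => n _; rewrite sum_cantor_intsD exchange_big /=.
  apply: ler_sum => z _.
  apply: le_trans (count_first_digits R L M n z e _) _.
    apply: le_trans he _; rewrite invfM -[leRHS]mul1r -[1 * _]mulrC.
    by rewrite ler_pM ?invr_ge0 // ?lef_pV2 ?posrE ?invf_le1 //; lra.
  apply: le_trans (fejer_indicator R K _ K0).
  rewrite ler_nat; case: (ltP (dist_int _)) => // lt1.
  by rewrite (lt_le_trans lt1).
under eq_bigr do rewrite -mulr_sumr.
rewrite -mulr_sumr.
have -> : \sum_(3 ^ l <= n < 3 ^ l.+1) \sum_(z <- cantor_ints M)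
    \sum_(j < K) \sum_(k < K) c j k n z =
    \sum_(j < K) \sum_(k < K) \sum_(3 ^ l <= n < 3 ^ l.+1)
      \sum_(z <- cantor_ints M) c j k n z.
  under eq_bigr do rewrite exchange_big /=.
  rewrite exchange_big /=; apply: eq_bigr => j _.
  under eq_bigr do rewrite exchange_big /=.
  by rewrite exchange_big.
have cjk (j k : 'I_K) : \sum_(3 ^ l <= n < 3 ^ l.+1) \sum_(z <- cantor_ints M) c j k n z
    <= 2 ^+ M * ((j == k)%:R * (2 * 3 ^+ l) + 2 ^+ l.+1).
  have [->|jk] := eqVneq j k.
    rewrite [leLHS](_ : _ = 2 ^+ M * (2 * 3 ^+ l)); last first.
      rewrite /c; under eq_bigr do under eq_bigr do rewrite subrr mul0r /cosc mul0r cos0.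
      rewrite sumr_const_nat big_const_seq count_predT size_cantor_ints iter_addr_0.
      rewrite -mulrnA mulnC natrM natrX mulrC; congr (_ * _).
      by rewrite (_ : 3 ^ l.+1 - 3 ^ l = 2 * 3 ^ l)%N ?natrM ?natrX // expnS; lia.
    by rewrite mul1r ler_pM2l ?exprn_gt0 // lerDl exprn_ge0.
  rewrite mul0r add0r.
  have {}jk : (j : nat) != k by [].
  have jK := ltn_ord j; have kK := ltn_ord k.
  (* With truncated subtraction this sum is the absolute difference of [j] and [k]. *)
  apply: (block_sum_cosc l M ((j - k) + (k - j))%N) => //; [lia|lia|].
  case: (leqP j k) => [le_jk|/ltnW le_kj].
    by rewrite (eqP le_jk) add0n distrC ger0_norm ?subr_ge0 ?ler_nat ?natrB.
  by rewrite (eqP le_kj) addn0 ger0_norm ?subr_ge0 ?ler_nat ?natrB.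
apply: le_trans (_ : _ <= 4 / K%:R ^+ 2 * \sum_(j < K) \sum_(k < K)
    (2 ^+ M * ((j == k)%:R * (2 * 3 ^+ l) + 2 ^+ l.+1))) _.
  rewrite ler_pM2l ?divr_gt0 ?exprn_gt0 //.
  by apply: ler_sum => j _; apply: ler_sum => k _.
have -> : \sum_(j < K) \sum_(k < K)
    (2 ^+ M * ((j == k)%:R * (2 * 3 ^+ l) + 2 ^+ l.+1)) =
    K%:R * (2 ^+ M * (2 * 3 ^+ l + K%:R * 2 ^+ l.+1)) :> R.
  transitivity (\sum_(j < K) 2 ^+ M * (2 * 3 ^+ l + K%:R * 2 ^+ l.+1) : R); last first.
    by rewrite sumr_const card_ord [RHS]mulr_natl.
  apply: eq_bigr => j _.
  rewrite -mulr_sumr big_split /= sumr_const card_ord -[2 ^+ l.+1 *+ K]mulr_natl.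
  congr (_ * (_ + _)); rewrite (bigD1 j) //= eqxx mul1r big1 ?addr0 // => k.
  by rewrite eq_sym => /negbTE ->; rewrite mul0r.
by rewrite [2 ^+ l.+1]exprS le_eqVlt; apply/orP; left; apply/eqP; field; lra.
Qed.

End BlockCount.

(** * Ternary expansions and measurability *)

Section TernaryExpansions.
Variable R : realType.
Implicit Types (a : R^nat) (x : R).

Definition digits02 a := forall k, a k = 0 \/ a k = 2.

Definition ternary_sum a m : R := series (fun k => a k / 3 ^+ k.+1) m.

Lemma ternary_sumS a m : ternary_sum a m.+1 = ternary_sum a m + a m / 3 ^+ m.+1.
Proof. exact: seriesSr. Qed.

Lemma ternary_sum0 a : ternary_sum a 0 = 0.
Proof. by rewrite /ternary_sum /series /= big_geq. Qed.

Lemma ternary_sum_bounds a m : digits02 a ->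
  0 <= ternary_sum a m <= 1 - 3 ^- m.
Proof.
move=> a02; elim: m => [|m IH].
  by rewrite ternary_sum0 expr0 invr1 subrr lexx.
have e3 : 0 < 3 ^- m.+1 :> R by rewrite invr_gt0 exprn_gt0.
have e : 3 ^- m = 3 * 3 ^- m.+1 :> R by rewrite exprS; field; rewrite expf_neq0.
by move: IH; rewrite ternary_sumS e; case: (a02 m) => ->; lra.
Qed.

Lemma ternary_expansion_bounds a x : digits02 a -> ternary_expansion a x ->
  0 <= x <= 1.
Proof.
move=> a02 ax; apply/andP; split.
  apply: (cvgr_to_ge ax); apply: nearW => m.
  by have /andP[] := ternary_sum_bounds a m a02.
apply: (cvgr_to_le ax); apply: nearW => m.
have /andP[_] := ternary_sum_bounds a m a02.
by move=> /le_trans; apply; rewrite gerBl invr_ge0 exprn_ge0.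
Qed.

(** Removing the first [m] digits and rescaling by [3 ^ m] shifts the expansion. *)
Lemma ternary_expansion_tail a x m : ternary_expansion a x ->
  ternary_expansion (fun k => a (k + m)%N) (3 ^+ m * (x - ternary_sum a m)).
Proof.
move=> ax.
rewrite /ternary_expansion.
have -> : series (fun k => a (k + m)%N / 3 ^+ k.+1) =
    (fun N => 3 ^+ m * (ternary_sum a (N + m) - ternary_sum a m)).
  apply/funext => N; elim: N => [|N IH].
    by rewrite add0n subrr mulr0 [LHS]ternary_sum0.
  rewrite -[LHS]/(ternary_sum (fun k => a (k + m)%N) N.+1) ternary_sumS.
  rewrite [ternary_sum _ N]IH addSn ternary_sumS -addSn exprD; field.
  by rewrite !expf_neq0.
apply: cvgM; [exact: cvg_cst|apply: cvgB]; last exact: cvg_cst.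
by rewrite (cvg_shiftn m (ternary_sum a)).
Qed.

Lemma ternary_expansion_sum_dist a x m : digits02 a -> ternary_expansion a x ->
  `|x - ternary_sum a m| <= 3 ^- m.
Proof.
move=> a02 /(ternary_expansion_tail _ _ m) /ternary_expansion_bounds.
move=> /(_ (fun k => a02 _))/andP[h0 h1].
have p3 : 0 < 3 ^+ m :> R by rewrite exprn_gt0.
rewrite pmulr_rge0 // in h0.
by rewrite ger0_norm // -[leRHS]mul1r ler_pdivlMr // mulrC.
Qed.

(** A point of the Cantor set is at most [1 / 3] or at least [2 / 3], so a cut at [1 / 2] reads off
    its first digit. *)
Definition digit (y : R) : R := if y <= 2^-1 then 0 else 2.

Definition ternary_map (y : R) : R := 3 * y - digit y.

(** The points whose orbit under the expanding map stays in [[0, 1]] are those with an expansion in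
    0 and 2. In this form the set is a countable intersection of preimages, hence Borel. *)
Lemma cantor_setE : @cantor_set R =
  \bigcap_k [set x : R | 0 <= iter k ternary_map x <= 1].
Proof.
apply/seteqP; split => x /=.
  move=> [_ [a [a02 ax]]] k _ /=.
  (* The iterates are the rescaled tails of the expansion. *)
  suff -> : iter k ternary_map x = 3 ^+ k * (x - ternary_sum a k).
    apply: ternary_expansion_bounds (ternary_expansion_tail _ _ k ax).
    by move=> j; exact: a02.
  elim: k => [|k IH].
    by rewrite ternary_sum0 subr0 mul1r.
  rewrite iterS IH ternary_sumS.
  have := ternary_expansion_bounds _ _ (fun j => a02 (j + k.+1)%N)
    (ternary_expansion_tail _ _ k.+1 ax).
  rewrite ternary_sumS.
  set y := 3 ^+ k * _.
  have -> : 3 ^+ k.+1 * (x - (ternary_sum a k + a k / 3 ^+ k.+1)) = 3 * y - a k.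
    by rewrite /y exprS; field; rewrite expf_neq0.
  by rewrite /ternary_map /digit; case: (a02 k) => ->; case: (leP y); lra.
move=> hx; split; first exact: (hx 0%N I).
(* Conversely the orbit supplies the digits, and the remainder after [k] of them is the [k]-th
   iterate over [3 ^ k], which tends to 0. *)
pose a k := digit (iter k ternary_map x).
exists a; split; first by move=> k; rewrite /a /digit; case: ifP; [left|right].
have sumE k : ternary_sum a k = x - iter k ternary_map x / 3 ^+ k.
  elim: k => [|k IH].
    by rewrite ternary_sum0 divr1 subrr.
  rewrite ternary_sumS IH iterS /ternary_map -/(a k) exprS; field.
  by rewrite expf_neq0.
apply/cvgrPdist_le => e e0.
have /cvgrPdist_le/(_ _ e0) : (3^-1 : R) ^+ n @[n --> \oo] --> 0.
  by apply: cvg_expr; rewrite ger0_norm ?invf_lt1 ?ltr1n.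
apply: filterS => k; rewrite sub0r normrN => hk.
rewrite -/(ternary_sum a k) sumE opprB addrC subrK.
apply: le_trans hk; rewrite normrM exprVn -[leRHS]mul1r ler_pM //.
  by have /andP[h0 h1] := hx k I; rewrite ger0_norm.
Qed.

Lemma measurable_cantor_set : measurable (@cantor_set R : set (measurableTypeR R)).
Proof.
rewrite cantor_setE; apply: bigcapT_measurable => k.
have mT : measurable_fun [set: measurableTypeR R] ternary_map.
  apply: measurable_funB; first by apply: measurable_funM.
  by apply: measurable_fun_ifT => //; exact: measurable_fun_ler.
have mI : measurable_fun [set: measurableTypeR R] (iter k ternary_map).
  by elim: k => [|k IH]; [exact: measurable_id|exact: measurableT_comp mT IH].
have := mI measurableT _ (@measurable_itv R `[0, 1]).
by rewrite setTI.
Qed.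

Lemma measurable_dist_int_lt n (e : R) :
  measurable [set x : measurableTypeR R | dist_int (2 ^+ n * x) < e].
Proof.
rewrite [X in measurable X](_ : _ =
  \bigcup_(i : int) [set x : R | `|2 ^+ n * x - i%:~R| < e]); last first.
  apply/seteqP; split => x /=; first by move=> /dist_int_ltP[i]; exists i.
  by move=> [i _ xi]; apply/dist_int_ltP; exists i.
apply: countable_bigcupT_measurable => [|i]; first exact: countableP.
rewrite -[X in measurable X]setTI.
have mf : measurable_fun [set: measurableTypeR R] (fun x : R => `|2 ^+ n * x - i%:~R| < e).
  apply: measurable_fun_ltr => //; apply: measurableT_comp => //.
  by apply: measurable_funB => //; exact: measurable_funM.
exact: (mf measurableT [set true]).
Qed.

End TernaryExpansions.

(** * The law of the first digits *)

(* Digits are numbered from the most significant one, as in [ternary_expansion]. *)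
Definition ternary_digit (m v j : nat) : nat := (v %/ 3 ^ (m - j.+1) %% 3)%N.

Lemma ternary_digitS m v e j : (e < 3)%N -> (j <= m)%N ->
  ternary_digit m.+1 (3 * v + e) j = if (j < m)%N then ternary_digit m v j else e.
Proof.
move=> e3; rewrite leq_eqVlt => /orP[/eqP ->|jm].
  by rewrite ltnn /ternary_digit subnn expn0 divn1 mulnC modnMDl modn_small.
rewrite jm /ternary_digit subSS (_ : m - j = (m - j.+1).+1)%N; last lia.
by rewrite expnS divnMA mulnC divnMDl // (divn_small e3) addn0.
Qed.

Lemma cantor_ints_digit m v j : v \in cantor_ints m -> (j < m)%N ->
  ternary_digit m v j = 0%N \/ ternary_digit m v j = 2%N.
Proof.
elim: m v => // m IH v; rewrite cantor_intsS.
move=> /allpairsP[[b e] /= [bm + ->]] jm.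
rewrite !inE => he; have e3 : (e < 3)%N by case/orP: he => /eqP ->.
rewrite ternary_digitS //; case: ltnP => [/(IH _ bm)//|_].
by case/orP: he => /eqP ->; [left|right].
Qed.

Lemma digits02_prefix (R : realType) (a : R^nat) m : digits02 R a ->
  exists2 v, v \in cantor_ints m &
    (forall j, (j < m)%N -> a j = (ternary_digit m v j)%:R) /\
    ternary_sum R a m = v%:R / 3 ^+ m.
Proof.
move=> a02; elim: m => [|m [v vm [dv sv]]].
  by exists 0%N; rewrite ?inE // ternary_sum0 mul0r.
have [e e02 ae] : exists2 e : nat, e \in [:: 0%N; 2%N] & a m = e%:R.
  by case: (a02 m) => ->; [exists 0%N|exists 2%N].
have e3 : (e < 3)%N by move: e02; rewrite !inE => /orP[] /eqP ->.
exists (3 * v + e)%N; first by rewrite cantor_intsS; apply: allpairs_f.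
split => [j jm|].
  rewrite ternary_digitS //; case: ltnP => [|mj]; first exact: dv.
  by rewrite (_ : j = m) //; lia.
rewrite ternary_sumS sv ae natrD natrM exprS; field.
by rewrite expf_neq0.
Qed.

Lemma measure_bigsetU_le d (T : measurableType d) (R : realType)
    (mu : {measure set T -> \bar R}) (I : Type) (s : seq I) (F : I -> set T) :
  (forall i, measurable (F i)) ->
  (mu (\big[setU/set0]_(i <- s) F i) <= \sum_(i <- s) mu (F i))%E.
Proof.
move=> mF; elim: s => [|i s IH]; first by rewrite !big_nil measure0.
rewrite !big_cons; apply: le_trans (measureU2 _ _ _) _ => //.
  exact: bigsetU_measurable.
exact: leeD.
Qed.

Section DigitProcess.
Context d (T : measurableType d) (R : realType) (P : probability T R).
Variable a : nat -> {RV P >-> R}.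
Hypothesis a_unif : forall k, uniform_on_02 P (a k).

Lemma digit_prob k (n : nat) : n = 0%N \/ n = 2%N ->
  P (a k @^-1` [set n%:R]) = (2^-1)%:E.
Proof. by case: (a_unif k) => u0 u2 [] ->. Qed.

(** The prefix event is an intersection over a finite set of indices, the form to which
    [mutually_independent] applies. *)
Definition cylinder (m v : nat) : set T :=
  \bigcap_(j in [set` [fset j in iota 0 m]%fset])
    a j @^-1` [set (ternary_digit m v j)%:R].

Lemma measurable_cylinder m v : measurable (cylinder m v).
Proof.
apply: fin_bigcap_measurable => [|j _]; first exact: finite_fset.
by have := measurable_funP (a j) measurableT _ (measurable_set1 (ternary_digit m v j)%:R);
  rewrite setTI.
Qed.

Hypothesis a_indep : mutually_independent P a.

Lemma cylinder_prob m v : v \in cantor_ints m ->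
  P (cylinder m v) = (2 ^- m)%:E.
Proof.
move=> vm; rewrite /cylinder (a_indep _ (fun j => [set (ternary_digit m v j)%:R])); last first.
  by move=> j _; exact: measurable_set1.
have prod_half (s : seq nat) : (\prod_(j <- s) (2^-1 : R)%:E = (2 ^- size s)%:E)%E.
  elim: s => [|j s IH]; first by rewrite big_nil expr0 invr1.
  by rewrite big_cons IH -EFinM exprS invfM.
have <- : (\prod_(j <- [fset j in iota 0 m]%fset) (2^-1 : R)%:E = (2 ^- m)%:E)%E.
  by rewrite prod_half card_fseq undup_id ?iota_uniq ?size_iota.
apply: eq_big_seq => j; rewrite !inE mem_iota => /andP[_ jm].
by rewrite digit_prob //; exact: cantor_ints_digit.
Qed.

(** The atoms at 0 and 2 already exhaust the total mass 1. *)
Lemma digits02_ae : {ae P, forall w, digits02 R (fun k => a k w)}.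
Proof.
suff h k : {ae P, forall w, a k w = 0 \/ a k w = 2}.
  exact: ae_foralln.
have m02 r : measurable (a k @^-1` [set r]).
  by have := measurable_funP (a k) measurableT _ (measurable_set1 r); rewrite setTI.
exists (~` (a k @^-1` [set 0] `|` a k @^-1` [set 2])); split.
- by apply: measurableC; exact: measurableU.
- rewrite probability_setC; last exact: measurableU.
  have p0 : P (a k @^-1` [set 0]) = (2^-1)%:E by have [] := a_unif k.
  have p2 : P (a k @^-1` [set 2]) = (2^-1)%:E by have [] := a_unif k.
  rewrite measureU //.
    rewrite [X in (1 - X)%E](_ : _ = (2^-1)%:E + (2^-1)%:E)%E; last first.
      by congr (_ + _)%E.
    transitivity (1 - (2^-1 + 2^-1) : R)%:E; first by rewrite EFinB EFinD.
    by congr EFin; lra.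
  by apply/seteqP; split => // w [/= -> /eqP]; rewrite eq_sym pnatr_eq0.
- by move=> w /= h [w0|w2]; apply: h; [left|right].
Qed.

End DigitProcess.

(** Truncating [x] to [m] digits moves [2 ^ n * x] by at most [2 ^ n / 3 ^ m <= e], so the radius
    grows to [2 * e]. Up to a null set the event is then covered by cylinders of probability
    [2 ^- m]. *)
Lemma cantor_measure_le (R : realType) (mu : probability (measurableTypeR R) R)
    n m (e : R) : is_cantor_measure mu -> 2 ^+ n <= e * 3 ^+ m ->
  (mu [set x : R | (dist_int (2 ^+ n * x) < e)%R] <=
    (2 ^- m * \sum_(v <- cantor_ints m)
      (dist_int (2 ^+ n * (v%:R / 3 ^+ m) : R) < 2 * e)%R%:R)%:E)%E.
Proof.
move=> [d [T [P [a [X [a_indep a_unif aX law]]]]]] he.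
set B := [set x | _]; have mB : measurable (B : set (measurableTypeR R)).
  exact: measurable_dist_int_lt.
have : P.-negligible (~` [set w | digits02 R (fun k => a k w) /\
    ternary_expansion (fun k => a k w) (X w)]).
  by apply: filterS2 (digits02_ae _ _ _ P a a_unif) aX => w; split.
move=> [N [mN N0 sN]].
pose c v := (dist_int (2 ^+ n * (v%:R / 3 ^+ m) : R) < 2 * e)%R.
pose U := \big[setU/set0]_(v <- seq.filter c (cantor_ints m)) cylinder _ _ _ P a m v.
have mU : measurable U by apply: bigsetU_measurable => v _; exact: measurable_cylinder.
have sub : X @^-1` B `<=` N `|` U.
  move=> w Bw; have [[a02 wX]|nw] := pselect (digits02 R (fun k => a k w) /\
    ternary_expansion (fun k => a k w) (X w)); last by left; exact: sN.
  right; have [v vm [dv sv]] := digits02_prefix R _ m a02.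
  rewrite /U -bigcup_seq; exists v; last first.
    by move=> j /=; rewrite !inE mem_iota add0n => /andP[_ jm]; exact: dv.
  rewrite /= mem_filter vm andbT /c -sv.
  have := ternary_expansion_sum_dist R _ _ m a02 wX.
  move: Bw => /dist_int_ltP[i hi] hs; apply/dist_int_ltP; exists i.
  have p2 : 0 < 2 ^+ n :> R by rewrite exprn_gt0.
  have p3 : 0 < 3 ^+ m :> R by rewrite exprn_gt0.
  have hs' : `|2 ^+ n * (X w - ternary_sum R (fun k => a k w) m)| <= e.
    rewrite normrM (ger0_norm (ltW p2)).
    apply: le_trans (ler_wpM2l (ltW p2) hs) _.
    by rewrite ler_pdivrMr.
  move: hi hs'; rewrite mulrBr !ltr_norml ler_norml; lra.
rewrite law //; apply: le_trans (_ : _ <= P (N `|` U))%E _.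
  apply: (@le_measure _ _ _ P); rewrite ?inE //; last exact: measurableU.
  by have := measurable_funP X measurableT _ mB; rewrite setTI.
apply: le_trans (measureU2 _ mN mU) _.
rewrite [X in (X + _ <= _)%E](_ : _ = 0%E) ?add0e; last exact: N0.
apply: le_trans (measure_bigsetU_le _ _ _ _ _ _ _ _) _ => [v|].
  exact: measurable_cylinder.
apply: le_trans (_ : _ <= \sum_(v <- cantor_ints m | c v) (2 ^- m)%:E)%E _.
  rewrite big_filter big_seq_cond [leRHS]big_seq_cond.
  by apply: lee_sum => v /andP[vm _]; rewrite -(cylinder_prob _ _ _ P _ a_unif a_indep _ _ vm).
rewrite sumEFin lee_fin mulr_sumr [leLHS]big_mkcond.
by apply: ler_sum => v _; rewrite /c; case: ifP => _; rewrite ?mulr1 ?mulr0.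
Qed.

(** * Summability *)

Lemma bernoulli_le (R : realType) (x : R) q : 0 <= x <= 1 ->
  1 - q%:R * x <= (1 - x) ^+ q.
Proof.
move=> /andP[x0 x1]; elim: q => [|q IH]; first by rewrite mul0r subr0 expr0.
have x1' : 0 <= 1 - x by rewrite subr_ge0.
rewrite exprS; apply: le_trans (ler_wpM2l x1' IH).
have q0 : 0 <= q%:R :> R by [].
rewrite -addn1 natrD; nra.
Qed.

Lemma exprn_ge_exists (R : realType) (x : R) : exists n : nat, x <= 3 ^+ n.
Proof.
exists (Num.bound `|x|); apply: le_trans (ler_norm x) _.
apply: le_trans (ltW (archi_boundP (normr_ge0 x))) _.
by rewrite -natrX ler_nat ltnW // ltn_expl.
Qed.

(** Serves to replace a real target for the order of the Fejer kernel by an integer, losing at most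
    a factor 2. *)
Lemma natr_half_approx (R : realType) (y : R) : 1 <= y ->
  exists2 K : nat, (0 < K)%N & K%:R <= y <= 2 * K%:R.
Proof.
move=> y1; have y0 : 0 <= y by lra.
exists (Num.truncn y); first by rewrite truncn_gt0.
have := truncn_itv y0 => /andP[ty yt]; rewrite ty /=.
have : 1 <= (Num.truncn y)%:R :> R by rewrite ler1n truncn_gt0.
by move: yt; rewrite -addn1 natrD; lra.
Qed.

Section Convergence.
Variables (R : realType) (mu : probability (measurableTypeR R) R).
Hypothesis mu_cantor : is_cantor_measure mu.

Definition near_dyadic (n : nat) (e : R) : set (measurableTypeR R) :=
  [set x : R | dist_int (2 ^+ n * x) < e].

(** The 12 in the hypothesis is the 6 of the Fejer radius times the 2 lost by truncation. The
    auxiliary level [M] cancels, [2 ^ M] against [2 ^- (L + M)]. *)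
Lemma block_measure (T : R) (l L K : nat) : 1 <= T -> (0 < K)%N ->
  12 * K%:R * 3 ^+ L <= T ^+ l ->
  \sum_(3 ^ l <= n < 3 ^ l.+1) fine (mu (near_dyadic n (T ^- l))) <=
  2 ^- L * (8 * 3 ^+ l / K%:R + 8 * 2 ^+ l).
Proof.
move=> T1 K0 hK; have K0' : 0 < K%:R :> R by rewrite ltr0n.
have Tl : 0 < T ^+ l by rewrite exprn_gt0 //; lra.
(* [M0] makes the truncation error at most [T ^- l] for the whole block; the summand [(K + l).+1] of
   [M] meets the condition of [block_count]. *)
have [M0 hM0] := exprn_ge_exists R (2 ^+ (3 ^ l.+1) * T ^+ l).
pose M := (K + l).+1 + M0.
have hM : 2 ^+ (3 ^ l.+1) * T ^+ l <= 3 ^+ (L + M) :> R.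
  by apply: le_trans hM0 _; rewrite ler_eXn2l ?ltr1n //; rewrite /M; lia.
have hsum : 2 ^- (L + M) * \sum_(3 ^ l <= n < 3 ^ l.+1) \sum_(v <- cantor_ints (L + M))
    ((dist_int (2 ^+ n * (v%:R / 3 ^+ (L + M)) : R) < 2 * T ^- l)%R%:R : R) <=
    2 ^- L * (8 * 3 ^+ l / K%:R + 8 * 2 ^+ l).
  rewrite [2 ^+ (L + M)]exprD invfM -[leLHS]mulrA ler_pM2l ?invr_gt0 ?exprn_gt0 //.
  rewrite ler_pdivrMl ?exprn_gt0 //.
  apply: block_count => //; first by rewrite /M; lia.
  rewrite -[leRHS]div1r ler_pdivlMr ?mulr_gt0 //.
  have -> : 3 ^+ L * (2 * T ^- l) * (6 * K%:R) = (12 * K%:R * 3 ^+ L) / T ^+ l.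
    by field; lra.
  by rewrite ler_pdivrMr // mul1r.
apply: le_trans hsum; rewrite mulr_sumr !big_nat; apply: ler_sum => n /andP[_ nl].
have mE : measurable (near_dyadic n (T ^- l)) by exact: measurable_dist_int_lt.
rewrite -lee_fin fineK ?fin_num_measure //.
apply: cantor_measure_le => //.
rewrite mulrC ler_pdivlMr //; apply: le_trans hM.
by rewrite ler_pM2r // ler_eXn2l ?ltr1n // ltnW.
Qed.

(* We split off [L = l + l %/ q] digits: the excess makes the term [2 ^ (l - L)]
   geometric, and [q] is large enough for [(3 / 2) ^ (l %/ q)] not to spoil the
   decay of [(9 / 2 / T) ^ l]. *)
Lemma block_measure_geometric (T : R) : 9 / 2 < T ->
  exists C rho : R, [/\ 0 <= C, 0 < rho < 1 & forall l,
    \sum_(3 ^ l <= n < 3 ^ l.+1) fine (mu (near_dyadic n (T ^- l))) <= C * rho ^+ l].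
Proof.
move=> hT; pose th : R := 9 / 2 / T.
have T0 : 0 < T by lra.
have th0 : 0 < th by rewrite divr_gt0 //; lra.
have th1 : th < 1 by rewrite ltr_pdivrMr // mul1r.
have [q q6 hq] : exists2 q : nat, (6 <= q)%N & th ^+ q <= 3^-1.
  have /cvgrPdist_le/(_ 3^-1) : th ^+ n @[n --> \oo] --> 0.
    by apply: cvg_expr; rewrite ger0_norm // ltW.
  case=> [|N _ hN]; first by rewrite invr_gt0.
  exists (N + 6)%N; first exact: leq_addl.
  have := hN (N + 6)%N (leq_addr _ _).
  by rewrite /= sub0r normrN ger0_norm // exprn_ge0 // ltW.
have q0 : 0 < q%:R :> R by rewrite ltr0n; lia.
(* By Bernoulli's inequality [rho ^ q >= 1 / 2], so [rho] stands in for a [q]-th root of [1 / 2]. *)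
pose rho : R := 1 - (2 * q%:R)^-1.
have rq : 2^-1 <= rho ^+ q.
  apply: le_trans (bernoulli_le _ _ _ _).
    by rewrite le_eqVlt; apply/orP; left; apply/eqP; field; lra.
  rewrite invr_ge0 mulr_ge0 ?(ltW q0) //= invf_le1 ?mulr_gt0 //.
  by rewrite -natrM ler1n; lia.
have rho01 : 0 < rho < 1.
  rewrite /rho subr_gt0 ltrBlDr ltrDl invr_gt0 mulr_gt0 // andbT.
  by rewrite invf_lt1 ?mulr_gt0 // -natrM ltr1n; lia.
have /andP[rho0 rho1] := rho01.
(* The second term covers [l < 2 * q] by the trivial bound [2 * 3 ^ l]; the first covers larger [l],
   with [200 = 192 + 8]. *)
exists (200 * rho ^- q + 2 * 3 ^+ (2 * q) * rho ^- (2 * q)), rho; split => //.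
  by rewrite addr_ge0 // !mulr_ge0 ?invr_ge0 ?exprn_ge0 // ltW.
move=> l; have [lq|ql] := ltnP l (2 * q).
  apply: le_trans (_ : _ <= 2 * 3 ^+ (2 * q)) _.
    apply: le_trans (_ : _ <= \sum_(3 ^ l <= n < 3 ^ l.+1) 1) _.
      apply: ler_sum => n _.
      have mE : measurable (near_dyadic n (T ^- l)) by exact: measurable_dist_int_lt.
      by rewrite -lee_fin fineK ?fin_num_measure // probability_le1.
    rewrite sumr_const_nat (_ : 3 ^ l.+1 - 3 ^ l = 2 * 3 ^ l)%N; last by rewrite expnS; lia.
    by rewrite natrM natrX ler_pM2l // ler_eXn2l ?ltr1n // ltnW.
  have rl : 1 <= rho ^- (2 * q) * rho ^+ l.
    rewrite mulrC ler_pdivlMr ?exprn_gt0 // mul1r.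
    by rewrite ler_wiXn2l ?ltW // ltnW.
  rewrite [leRHS]mulrDl -[leLHS]add0r lerD //.
    by rewrite !mulr_ge0 ?invr_ge0 ?exprn_ge0 // ltW.
  by rewrite -[leRHS]mulrA ler_peMr ?mulr_ge0 ?exprn_ge0.
pose s := (l %/ q)%N.
have s2 : (2 <= s)%N by rewrite leq_divRL //; lia.
have qs : (q * s <= l)%N by rewrite mulnC leq_trunc_div.
have pow_s : 2 ^- s <= rho ^- q * rho ^+ l.
  rewrite mulrC ler_pdivlMr ?exprn_gt0 //.
  apply: le_trans (_ : _ <= (rho ^+ q) ^+ s * rho ^+ q) _.
    rewrite ler_pM2r ?exprn_gt0 // -exprVn.
    by rewrite lerXn2r ?nnegrE ?invr_ge0 // exprn_ge0 // ltW.
  rewrite -exprM -exprD ler_wiXn2l ?(ltW rho0) ?(ltW rho1) //.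
  by rewrite addnC -mulnS mulnC ltnW // ltn_ceil //; lia.
(* [K] is, up to a factor 2, the largest order that [block_measure] allows. The target is at least 1
   because [T / 3 > 3 / 2], [l >= 6 * s], and [12 <= (243 / 64) ^ s] for [s >= 2]. *)
have [K K0 /andP[Ky yK]] : exists2 K : nat, (0 < K)%N &
    K%:R <= T ^+ l / (12 * 3 ^+ (l + s)) <= 2 * K%:R.
  apply: natr_half_approx; rewrite ler_pdivlMr ?mulr_gt0 ?exprn_gt0 // mul1r.
  have -> : T ^+ l = 3 ^+ l * (T / 3) ^+ l by rewrite -exprMn; congr (_ ^+ _); field.
  have -> : 12 * 3 ^+ (l + s) = 3 ^+ l * (12 * 3 ^+ s) :> R by rewrite exprD; ring.
  rewrite ler_pM2l ?exprn_gt0 //.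
  apply: le_trans (_ : _ <= (3 / 2) ^+ l) _; last first.
    by rewrite lerXn2r ?nnegrE ?divr_ge0 ?ltW //; lra.
  apply: le_trans (_ : _ <= (3 / 2) ^+ (6 * s)) _; last first.
    rewrite ler_eXn2l; last lra.
    by apply: leq_trans qs; rewrite leq_mul2r q6 orbT.
  rewrite exprM (_ : (3 / 2) ^+ 6 = 243 / 64 * 3 :> R); last by field.
  rewrite exprMn ler_pM2r ?exprn_gt0 //.
  apply: le_trans (_ : _ <= (243 / 64) ^+ 2) _; first by lra.
  by rewrite ler_eXn2l //; lra.
have K0' : 0 < K%:R :> R by rewrite ltr0n.
apply: le_trans (block_measure T l (l + s) K _ K0 _) _; first lra.
  move: Ky; rewrite ler_pdivlMr ?mulr_gt0 ?exprn_gt0 //.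
  by rewrite mulrA [K%:R * 12]mulrC.
apply: le_trans (_ : _ <= 200 * 2 ^- s) _; last first.
  apply: le_trans (_ : _ <= 200 * rho ^- q * rho ^+ l) _.
    by rewrite -mulrA ler_pM2l.
  by rewrite [leRHS]mulrDl lerDl !mulr_ge0 ?invr_ge0 ?exprn_ge0 // ltW.
have th_l : th ^+ l <= 3 ^- s.
  apply: le_trans (_ : _ <= (th ^+ q) ^+ s) _.
    by rewrite -exprM ler_wiXn2l // ltW.
  by rewrite -exprVn lerXn2r ?nnegrE ?invr_ge0 // exprn_ge0 // ltW.
have Tl : 0 < T ^+ l by rewrite exprn_gt0.
have K_inv : K%:R^-1 <= 24 * 3 ^+ (l + s) / T ^+ l.
  move: yK; rewrite ler_pdivrMr ?mulr_gt0 ?exprn_gt0 // => yK.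
  rewrite -[leLHS]div1r ler_pdivrMr // mulrAC ler_pdivlMr // mul1r.
  by apply: le_trans yK _; rewrite le_eqVlt; apply/orP; left; apply/eqP; ring.
apply: le_trans (_ : _ <= 2 ^- (l + s) *
    (8 * 3 ^+ l * (24 * 3 ^+ (l + s) / T ^+ l) + 8 * 2 ^+ l)) _.
  rewrite ler_pM2l ?invr_gt0 ?exprn_gt0 // lerD2r.
  by rewrite ler_pM2l // mulr_gt0 // exprn_gt0.
have -> : 2 ^- (l + s) * (8 * 3 ^+ l * (24 * 3 ^+ (l + s) / T ^+ l) + 8 * 2 ^+ l) =
    192 * 2 ^- s * 3 ^+ s * th ^+ l + 8 * 2 ^- s.
  have -> : th ^+ l = 3 ^+ l * 3 ^+ l / 2 ^+ l / T ^+ l.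
    by rewrite /th !expr_div_n -exprMn; congr (_ ^+ _ / _ / _); ring.
  by rewrite !exprD; field; rewrite !expf_neq0 //; lra.
have : 192 * 2 ^- s * 3 ^+ s * th ^+ l <= 192 * 2 ^- s * 3 ^+ s * 3 ^- s.
  by rewrite ler_wpM2l // !mulr_ge0 ?invr_ge0 ?exprn_ge0.
by rewrite mulfK ?expf_neq0 //; lra.
Qed.

(** Radii on block [l] are at most [T ^- l], so the block sums are dominated by a geometric series.
    The blocks start at [3 ^ 0 = 1], and the event for [n = 0] is empty. *)
Lemma near_dyadic_summable (f : nat -> R) (T : R) : 9 / 2 < T ->
  (forall l n, (3 ^ l <= n)%N -> f n <= T ^- l) ->
  (\sum_(n <oo) mu [set x | (0 < n)%N /\ near_dyadic n (f n) x] < +oo)%E.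
Proof.
move=> hT hf; have [C [rho [C0 /andP[r0 r1] hC]]] := block_measure_geometric T hT.
pose E n := [set x | (0 < n)%N /\ near_dyadic n (f n) x].
have mE n : measurable (E n).
  case: n => [|n]; first by rewrite (_ : E 0%N = set0) //; apply/seteqP; split => x [].
  rewrite (_ : E n.+1 = near_dyadic n.+1 (f n.+1)); first exact: measurable_dist_int_lt.
  by apply/seteqP; split => x //= [].
have finE n : mu (E n) = (fine (mu (E n)))%:E by rewrite fineK ?fin_num_measure.
have sumE l : \sum_(1 <= n < 3 ^ l) fine (mu (E n)) <= C / (1 - rho) * (1 - rho ^+ l).
  elim: l => [|l IH].
    by rewrite expn0 big_geq // expr0 subrr mulr0.
  rewrite (@big_cat_nat _ _ _ (3 ^ l)) ?expn_gt0 ?leq_exp2l //=.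
  have -> : C / (1 - rho) * (1 - rho ^+ l.+1) =
      C / (1 - rho) * (1 - rho ^+ l) + C * rho ^+ l by rewrite exprS; field; lra.
  apply: lerD => //; apply: le_trans (hC l); rewrite !big_nat.
  apply: ler_sum => n /andP[ln _].
  apply: fine_le; rewrite ?fin_num_measure //; first exact: measurable_dist_int_lt.
  apply: le_measure; rewrite ?inE //; first exact: measurable_dist_int_lt.
  by move=> x [_]; rewrite /near_dyadic /= => /lt_le_trans; apply; exact: hf.
apply: (@le_lt_trans _ _ (C / (1 - rho))%:E); last exact: ltry.
apply: lime_le; first exact: is_cvg_nneseries.
apply: nearW => N.
rewrite [leLHS](_ : _ = (\sum_(0 <= n < N) fine (mu (E n)))%:E); last first.
  by rewrite -sumEFin; apply: eq_bigr => n _; exact: finE.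
rewrite lee_fin.
(* Since [N < 3 ^ N], the first [N] blocks contain all positive indices below [N]. *)
apply: le_trans (_ : _ <= \sum_(1 <= n < 3 ^ N) fine (mu (E n))) _.
  have e0 n : 0 <= fine (mu (E n)) by exact: fine_ge0.
  case: N => [|N]; first by rewrite big_geq // sumr_ge0.
  rewrite big_ltn // [E 0%N](_ : _ = set0) ?measure0 ?add0r; last first.
    by apply/seteqP; split => x [].
  rewrite [leRHS](@big_cat_nat _ _ _ N.+1) //=; last by rewrite ltnW // ltn_expl.
  by rewrite lerDl sumr_ge0.
apply: le_trans (sumE N) _.
have d0 : 0 <= C / (1 - rho) by rewrite divr_ge0 // subr_ge0 ltW.
by rewrite ler_piMr // gerBl exprn_ge0 // ltW.
Qed.

End Convergence.

(** * Infinitely many exponents and the Borel-Cantelli lemma *)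

(** Unboundedness is the form that membership in [lim_sup_set] unfolds to. *)
Lemma infinite_set_natP (A : set nat) :
  ~ finite_set A <-> forall n, exists2 k, (n <= k)%N & A k.
Proof.
split=> [infA n | unbA /finite_fsetP[X AX]].
  apply: contrapT => noA; apply: infA.
  apply: (@sub_finite_set _ _ `I_n); last exact: finite_II.
  move=> k Ak /=; rewrite ltnNge; apply/negP => nk.
  by apply: noA; exists k.
have [k Xk Ak] := unbA (\max_(i <- X) i)%N.+1.
move: Ak; rewrite AX /= => kX.
by have := @leq_bigmax_seq _ (X : seq nat) xpredT id k kX isT; rewrite leqNgt Xk.
Qed.

(** The critical exponent satisfies [3 ^ (2 - ln 2 / ln 3) = 9 / 2]. *)
Lemma powR3_gt (R : realType) (tau : R) : 2 - ln 2 / ln 3 < tau ->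
  9 / 2 < 3 `^ tau :> R.
Proof.
have l3 : 0 < ln 3 :> R by rewrite ln_gt0 // ltr1n.
move=> htau; rewrite -ltr_ln ?posrE ?powR_gt0 //.
rewrite ln_powR ln_div ?posrE //.
have -> : ln 9 = 2 * ln 3 :> R.
  by rewrite (_ : 9 = 3 ^+ 2) ?lnXn //; ring.
have -> : 2 * ln 3 - ln 2 = (2 - ln 2 / ln 3) * ln 3 :> R by field; lra.
by rewrite ltr_pM2r.
Qed.

Theorem theorem1 (R : realType) (mu : probability (measurableTypeR R) R)
    (tau : R) :
  is_cantor_measure mu ->
  2 - ln 2 / ln 3 < tau ->
  mu [set x : R | cantor_set x /\
        infinite_set [set n : nat | (0 < n)%N /\
          dist_int (2 ^+ n * x) < n%:R `^ (- tau)]] = 0%E.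

Proof.
move=> mu_cantor htau.
pose E n := [set x : measurableTypeR R |
  (0 < n)%N /\ near_dyadic R n (n%:R `^ (- tau)) x].
have T92 := powR3_gt R tau htau.
have tau0 : 0 <= tau.
  have l2 : 0 < ln 2 :> R by rewrite ln_gt0 // ltr1n.
  have : ln 2 < ln 3 :> R by rewrite ltr_ln ?posrE // ltr_nat.
  move=> l23; have : ln 2 / ln 3 < 1 :> R by rewrite ltr_pdivrMr ?mul1r //; lra.
  lra.
have mE n : measurable (E n).
  case: n => [|n]; first by rewrite (_ : E 0%N = set0) //; apply/seteqP; split => x [].
  rewrite (_ : E n.+1 = near_dyadic R n.+1 (n.+1%:R `^ (- tau))).
    exact: measurable_dist_int_lt.
  by apply/seteqP; split => x //= [].
have f_le l n : (3 ^ l <= n)%N -> n%:R `^ (- tau) <= (3 `^ tau) ^- l.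
  move=> ln; rewrite powRN lef_pV2 ?posrE ?exprn_gt0 ?powR_gt0 //; last first.
    by rewrite ltr0n (leq_trans _ ln) ?expn_gt0.
  rewrite -powR_mulrn ?powR_ge0 // powRAC powR_mulrn // -natrX.
  by rewrite ge0_ler_powR ?nnegrE // ler_nat.
(* This is the first Borel-Cantelli lemma, applied with [T] equal to 3 to the power [tau]. *)
have limE0 : mu (lim_sup_set E) = 0.
  by apply: lim_sup_set_cvg0 => //; exact: (near_dyadic_summable _ _ _ _ _ T92).
have mlim : measurable (lim_sup_set E).
  by apply: bigcapT_measurable => n; apply: bigcup_measurable.
rewrite [X in mu X](_ : _ = @cantor_set R `&` lim_sup_set E); last first.
  apply/seteqP; split => x [Cx].
    move=> /infinite_set_natP inf; split => // n _.
    by have [k nk [k0 hk]] := inf n; exists k.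
  move=> limx; split => //; apply/infinite_set_natP => n.
  by have [k nk [k0 hk]] := limx n I; exists k.
apply/eqP; rewrite eq_le measure_ge0 andbT -limE0.
apply: le_measure; rewrite ?inE //; apply: measurableI => //.
exact: measurable_cantor_set.
Qed.
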